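(* Let $s\ge1$, let $\beta_1,\dotsc,\beta_s$ be positive integers, $|\boldsymbol\beta|=\beta_1+\dotsb+\beta_s$, and let $n$ be a positive integer. Consider the expansion of \[ F_{\boldsymbol\beta,q}[s;1]=\prod_{1\le i<j\le s}\Big(\frac{z_i}{z_j};q\Big)_{\beta_i}\Big(\frac{qz_j}{z_i};q\Big)_{\beta_j}\prod_{i=1}^s\Big(\frac{z_i}{w_1};q\Big)_{\beta_i}^{-1}. \] Then the monomial $z_1^{k_1}z_2^{k_2}\dotsm z_s^{k_s}/w_1^n$ does not appear in this expansion if $k_i<n$ for all $i=1,\dotsc,s$. Moreover, for each $a\in\{1,\dotsc,s\}$, the coefficient of $z_a^n/w_1^n$ in this expansion is \[ q^{\sum_{j=a+1}^s\beta_j}\frac{(1-q^{\beta_a})(q;q)_{|\boldsymbol\beta|-\beta_a}}{(q;q)_{\beta_1}(q;q)_{\beta_2}\dotsm(q;q)_{\beta_s}}\,(q^{|\boldsymbol\beta|-\beta_a+n+1};q)_{\beta_a-1}. \]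
   Context: $(z;q)_n=(1-z)(1-qz)\dotsm(1-q^{n-1}z)$, $(z;q)_0=1$. The expansion is the formal series obtained by expanding each factor $(1-q^bz_i/w_1)^{-1}$ as $\sum_{m\ge0}(q^bz_i/w_1)^m$ (i.e. in the region $|q^bz_i/w_1|<1$), the other factors being Laurent polynomials in the $z_i$. *)

(* Defs.v *)
From HB Require Import structures.
From mathcomp Require Import all_boot all_order all_algebra.
Set Implicit Arguments. Unset Strict Implicit. Unset Printing Implicit Defensive.
Import Order.TTheory GRing.Theory Num.Theory.
Local Open Scope ring_scope.

Definition qpoch (R : nzRingType) (z q : R) (n : nat) : R :=
  \prod_(i < n) (1 - q ^+ i * z).

(* Laurent monomials in z_1..z_s (indices 'I_s) and w_1:
   a pair (exponent vector of the z's, exponent of w_1). *)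
Definition lmon (s : nat) := ({ffun 'I_s -> int} * int)%type.

(* A Laurent polynomial, written as a formal (unreduced) list of terms
   coefficient * monomial. *)
Definition lpol (R : nzRingType) (s : nat) := seq (R * lmon s).

Definition lmon_mul s (m1 m2 : lmon s) : lmon s :=
  ([ffun i => m1.1 i + m2.1 i], m1.2 + m2.2).

Definition lmon_one s : lmon s := ([ffun => 0], 0).

Definition lpmul (R : nzRingType) s (p1 p2 : lpol R s) : lpol R s :=
  [seq (t1.1 * t2.1, lmon_mul t1.2 t2.2) | t1 <- p1, t2 <- p2].

Definition lpone (R : nzRingType) s : lpol R s := [:: (1, lmon_one s)].

Definition lpcoef (R : nzRingType) s (p : lpol R s) (m : lmon s) : R :=
  \sum_(t <- p | t.2 == m) t.1.

Definition zratio s (i j : 'I_s) : lmon s :=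
  ([ffun l => ((l == i) : nat)%:Z - ((l == j) : nat)%:Z], 0).

Definition zw s (i : 'I_s) : lmon s :=
  ([ffun l => ((l == i) : nat)%:Z], -1).

Definition lqpoch (R : nzRingType) s (c q : R) (m : lmon s) (beta : nat) : lpol R s :=
  \big[@lpmul R s/lpone R s]_(b < beta) [:: (1, lmon_one s); (- (q ^+ b * c), m)].

Definition lmon_exp s (m : lmon s) (t : nat) : lmon s :=
  ([ffun i => m.1 i *+ t], m.2 *+ t).

Definition lgeom (R : nzRingType) s (c : R) (m : lmon s) (N : nat) : lpol R s :=
  [seq (c ^+ t, lmon_exp m t) | t <- iota 0 N.+1].

Definition lqpoch_inv (R : nzRingType) s (c q : R) (m : lmon s) (beta N : nat)
  : lpol R s :=
  \big[@lpmul R s/lpone R s]_(b < beta) lgeom (q ^+ b * c) m N.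

Definition Ftrunc (R : nzRingType) s (beta : 'I_s -> nat) (q : R) (N : nat)
  : lpol R s :=
  lpmul
   (\big[@lpmul R s/lpone R s]_(i < s)
      \big[@lpmul R s/lpone R s]_(j < s | (i < j)%N)
         lpmul (lqpoch 1 q (zratio i j) (beta i))
               (lqpoch q q (zratio j i) (beta j)))
   (\big[@lpmul R s/lpone R s]_(i < s) lqpoch_inv 1 q (zw i) (beta i) N).

(* Coefficient of z_1^{k_1}...z_s^{k_s} / w_1^n in the expansion of
   F_{beta,q}[s;1].  Since the Laurent-polynomial part does not involve w_1
   and each geometric term (q^b z_i/w_1)^t contributes w_1^{-t}, only terms
   with t <= n contribute; hence truncating at degree n is exact. *)
Definition Fcoef (R : nzRingType) s (beta : 'I_s -> nat) (q : R)
  (k : 'I_s -> int) (n : nat) : R :=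
  lpcoef (Ftrunc beta q n) ([ffun i => k i], - (n%:Z)).

(* Main.v *)
Require Import Defs.
From HB Require Import structures.
From mathcomp Require Import all_boot all_order all_algebra.
From mathcomp Require Import fraction mpoly ring zify.
Import Order.TTheory GRing.Theory Num.Theory.
Local Open Scope ring_scope.

(** Let [X] be the alphabet of all [q^b z_i] with [b < beta_i]. The coefficient of
  [w_1^-n] in [prod_i (z_i/w_1;q)_{beta_i}^-1] is [h_n(X)], and partial fractions give
  [h_n(X) = sum_x A_x x^n] with [A_x = prod_{y <> x} (1 - y/x)^-1].
  For [x = q^b z_i], the denominators of [A_x] are cancelled by the factors of the
  Dyson product [D] that involve [z_i], and what is left of these is a polynomial in
  the [z_i/z_j]. So every monomial of [D A_x x^n] has exponent at least [n] in [z_i],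
  which gives the vanishing; and the part of exponent exactly [n] is
  [const * z_i^n * D'] with [D'] the Dyson product of the other variables.
  For [n = 0] this, together with [sum_x A_x = 1], is a recursion for the constant term
  of [D], which yields the q-Dyson theorem; then [n > 0] gives the coefficient of
  [z_a^n/w_1^n].
  All this needs [q] to be neither [0] nor a root of unity, so it is carried out over
  the fraction field of [{poly R}] with [q = 'X] and specialized at the end. *)

(** * Partial fractions and complete homogeneous sums *)

(** Lagrange interpolation at the points [(x k)^-1]: there every summand but the [k]-th contains the
    vanishing factor [1 - x k *: 'X], and the [k]-th is 1. Both sides have degree below the number
    of these points. *)
Lemma lagrange_one (K : fieldType) (I : finType) (P : pred I) (x : I -> K) :
  {in P &, injective x} -> {in P, forall i, x i != 0} -> (exists i, P i) ->
  \sum_(i | P i) (\prod_(j | P j && (j != i)) (1 - x j / x i))^-1 *: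
     \prod_(j | P j && (j != i)) (1 - x j *: 'X) = 1 :> {poly K}.
Proof.
move=> inj nz [i0 Pi0].
pose s := [seq (x i)^-1 | i <- enum P].
have us : uniq s.
  rewrite map_inj_in_uniq ?enum_uniq // => i j; rewrite !mem_enum => Pi Pj /invr_inj; exact: inj.
have size1 (a : K) : (size (1 - a *: 'X : {poly K})%R <= 2)%N.
  rewrite (leq_trans (size_polyD _ _)) // geq_max size_poly1 size_polyN.
  by rewrite (leq_trans (size_scale_leq _ _)) // size_polyX.
apply/eqP; rewrite -subr_eq0; apply/eqP.
apply: (@roots_geq_poly_eq0 _ _ s) => //.
  apply/allP => y /mapP[k]; rewrite mem_enum => Pk0 ->; have Pk : P k by [].
 
  rewrite /root hornerD hornerN hornerC horner_sum (bigD1 k) //= [X in _ + X - 1]big1.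
    rewrite addr0 hornerZ horner_prod.
    under [X in _ * X]eq_bigr do rewrite !hornerE.
    rewrite mulVf ?subrr // prodf_seq_neq0; apply/allP => j _.
    apply/implyP => /andP[Pj jk]; rewrite subr_eq0 eq_sym.
    apply: contra jk => /eqP e; apply/eqP; apply: inj => //.
    by rewrite -[x j](@divfK _ (x k)) ?nz // e mul1r.
  move=> i /andP[Pi ik]; rewrite hornerZ horner_prod [X in _ * X](bigD1 k) /=; last by rewrite Pk eq_sym.
  by rewrite hornerD hornerN hornerZ hornerX hornerC divff ?nz // subrr mul0r mulr0.
rewrite size_map -cardE.
have cP : (0 < #|P|)%N by apply/card_gt0P; exists i0.
rewrite (leq_trans (size_polyD _ _)) // geq_max size_polyN size_poly1 cP andbT.
rewrite (leq_trans (size_sum _ _ _)) //; apply/bigmax_leqP => i Pi.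
rewrite (leq_trans (size_scale_leq _ _)) // (leq_trans (size_prod_leq _ _)) //.
rewrite leq_subLR (cardD1 i P) (_ : i \in P) //.
rewrite (@eq_card _ _ [predD1 P & i]); last by move=> j; rewrite !inE andbC.
rewrite add1n addnS ltnS addnn -muln2.
rewrite -(@eq_card _ [pred j | P j && (j != i)]); last by move=> j; rewrite !inE andbC.
by rewrite -sum_nat_const; apply: leq_sum => j _; exact: size1.
Qed.

(* Both sides are compared after multiplication by [\prod_i (1 - x_i 'X)], which is
   invertible modulo ['X^(N.+1)]. *)
Lemma complete_homogeneous (K : fieldType) (I : finType) (P : pred I) (x : I -> K) (n N : nat) :
  {in P &, injective x} -> {in P, forall i, x i != 0} -> (exists i, P i) ->
  (n <= N)%N ->
  (\prod_(i | P i) \sum_(t < N.+1) (x i ^+ t) *: 'X^t : {poly K})`_n =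
  \sum_(i | P i) (\prod_(j | P j && (j != i)) (1 - x j / x i))^-1 * x i ^+ n.
Proof.
move=> inj nz exP nN.
pose G i : {poly K} := \sum_(t < N.+1) (x i ^+ t) *: 'X^t.
have GE i : G i * (1 - x i *: 'X) = 1 - x i ^+ N.+1 *: 'X^(N.+1).
  rewrite -exprZn -[1 - _ ^+ _]opprB subrX1 -mulNr opprB mulrC; congr (_ * _).
  by apply: eq_bigr => t _; rewrite exprZn.
pose A i := (\prod_(j | P j && (j != i)) (1 - x j / x i))^-1.
pose Pi := \prod_(i | P i) (1 - x i *: 'X : {poly K}).
pose dif := \prod_(i | P i) G i - \sum_(i | P i) A i *: G i.
have difE : exists Q, dif * Pi = 'X^(N.+1) * Q.
  have h1 : exists Q, \prod_(i | P i) G i * Pi = 1 + 'X^(N.+1) * Q.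
    rewrite -big_split /=; apply: (big_ind (fun p => exists Q, p = 1 + 'X^(N.+1) * Q)).
    - by exists 0; rewrite mulr0 addr0.
    - move=> _ _ [Q1 ->] [Q2 ->]; exists (Q1 + Q2 + 'X^(N.+1) * Q1 * Q2); ring.
    - move=> i _; rewrite GE; exists (- (x i ^+ N.+1)%:P).
      by rewrite -mul_polyC mulrN mulrC.
  have h2 : exists Q, (\sum_(i | P i) A i *: G i) * Pi = 1 + 'X^(N.+1) * Q.
    (* By [GE], each summand times [Pi] is the matching summand of [lagrange_one] minus a multiple
       of ['X^(N.+1)]; the witness collects these multiples. *)
    exists (- \sum_(i | P i) (A i * x i ^+ N.+1) *: \prod_(j | P j && (j != i)) (1 - x j *: 'X)).
    rewrite mulr_suml mulrN mulr_sumr -[X in _ = X - _](lagrange_one _ _ P x) // -sumrB.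
    apply: eq_bigr => i Pi_; rewrite /Pi (bigD1 i) //= -scalerAl mulrA GE -/(A i).
    by rewrite -!mul_polyC polyCM; ring.
  case: h1 => Q1 h1; case: h2 => Q2 h2; exists (Q1 - Q2).
  rewrite /dif mulrBl h1 h2; ring.
have Pi0 : Pi`_0 = 1.
  rewrite -horner_coef0 horner_prod big1 // => i _.
  by rewrite hornerD hornerN hornerZ hornerX hornerC mulr0 subr0.
suff : forall m, (m <= N)%N -> dif`_m = 0.
  move/(_ n nN) => /eqP; rewrite /dif coefB subr_eq0 => /eqP ->.
  rewrite coef_sum; apply: eq_bigr => i Pi_; rewrite coefZ /G coef_sum.
  rewrite (bigD1 (Ordinal (nN : n < N.+1)%N)) //= coefZ coefXn eqxx mulr1 big1 ?addr0 //.
  move=> t tn; rewrite coefZ coefXn; case: eqP => [e|]; last by rewrite mulr0.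
  by case/eqP: tn; apply: val_inj.
(* Since [Pi] has constant term 1, the coefficient of ['X^m] in [dif * Pi] is that of [dif] plus
   terms with lower coefficients of [dif]. *)
elim/ltn_ind => m IH mN.
case: difE => Q /(congr1 (fun p : {poly K} => p`_m)).
rewrite coefXnM ltnS mN coefM big_ord_recr /= subnn Pi0 mulr1 big1 ?add0r //.
move=> t _; rewrite IH ?mul0r //; last exact: leq_trans (ltnW (ltn_ord t)) mN.
Qed.

(** * q-Pochhammer symbols and letters of a single variable *)

Lemma qpochS (R : comNzRingType) (z q : R) m :
  qpoch z q m.+1 = (1 - z) * qpoch (q * z) q m.
Proof.
rewrite /qpoch big_ord_recl expr0 mul1r; congr (_ * _).
by apply: eq_bigr => i _; rewrite exprSr mulrA.
Qed.

Lemma qpochSr (R : nzRingType) (z q : R) m :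
  qpoch z q m.+1 = qpoch z q m * (1 - q ^+ m * z).
Proof. by rewrite /qpoch big_ord_recr. Qed.

Lemma qpochD (R : comNzRingType) (z q : R) m n :
  qpoch z q (m + n) = qpoch z q m * qpoch (q ^+ m * z) q n.
Proof.
elim: n => [|n IH]; first by rewrite addn0 [qpoch _ _ 0]big_ord0 mulr1.
by rewrite addnS !qpochSr IH mulrA exprD mulrA (mulrC (q ^+ n)).
Qed.

(* The self-interaction of [x = q^b z_i] in [A_x]; [c] ranges over the other
   exponents of the same variable. *)
Definition kappa (K : fieldType) (q : K) (m b : nat) : K :=
  (\prod_(c < m | c != b :> nat) (1 - q ^+ c / q ^+ b))^-1.

Arguments kappa {K}.

Section Kappa.
Variables (K : fieldType) (q : K).
Hypothesis q0 : q != 0.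
Hypothesis q1 : forall m, (0 < m)%N -> q ^+ m != 1.

Lemma expq_inj : injective (fun m => q ^+ m).
Proof.
move=> a b /=; wlog ab : a b / (a <= b)%N => [H|].
  by move=> e; case/orP: (leq_total a b) => h; [|symmetry]; apply: H.
rewrite -{1}(subnK ab) exprD -{1}[q ^+ a]mul1r => /mulIf h.
have /eqP : q ^+ (b - a) = 1 by rewrite -h // expf_neq0.
by case: (posnP (b - a)) => [|/q1/negbTE->]//; lia.
Qed.

Lemma qpoch_neq0 m : qpoch q q m != 0.
Proof.
apply/prodf_neq0 => i _; rewrite -exprSr subr_eq0 eq_sym; exact: q1.
Qed.

(** The exponent [m] joins at the top; in [kappa_first] the exponent 0 joins at the bottom. Together
    they give the recursion in [sum_kappa]. *)
Lemma kappa_last m b : (b < m)%N ->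
  kappa q m b = kappa q m.+1 b * (1 - q ^+ m / q ^+ b).
Proof.
move=> bm; rewrite /kappa big_mkcond [in RHS]big_mkcond big_ord_recr /=.
have mb : m != b by lia.
rewrite mb invfM mulfVK // subr_eq0 eq_sym.
by apply: contra mb => /eqP/divr1_eq/expq_inj ->.
Qed.

Lemma kappa_first m b :
  kappa q m b = kappa q m.+1 b.+1 * (1 - (q ^+ b.+1)^-1).
Proof.
rewrite /kappa big_mkcond [in RHS]big_mkcond big_ord_recl /= expr0 div1r.
rewrite invfM mulrAC mulVf ?mul1r.
  congr (_^-1); apply: eq_bigr => c _; rewrite /bump /= add1n eqSS.
  case: ifP => // _; congr (1 - _).
  by rewrite !exprS -mulf_div divff ?mul1r.
by rewrite subr_eq0 eq_sym invr_eq1 q1.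
Qed.

(** By partial fractions the left side is h_N(1, q, ..., q^m), a q-binomial coefficient. The
    induction rests on its recursion [key], which lowers [m] and raises [N]. *)
Lemma sum_kappa m N :
  \sum_(b < m.+1) kappa q m.+1 b * (q ^+ b) ^+ N = qpoch (q ^+ N.+1) q m / qpoch q q m.
Proof.
elim: m N => [|m IH] N.
  rewrite big_ord1 /kappa big_pred0 ?invr1 ?expr1n ?mul1r; last by move=> c; rewrite ord1.
  by rewrite /qpoch !big_ord0 divr1.
(* The two parts of [1 - q ^+ N.+1] give sums that extend to [b < m.+2], because the factors from
   [kappa_last] and [kappa_first] vanish at [b = m.+1] and [b = 0] respectively. *)
have key : (1 - q ^+ m.+1) * \sum_(b < m.+2) kappa q m.+2 b * (q ^+ b) ^+ N =
  (1 - q ^+ N.+1) * \sum_(b < m.+1) kappa q m.+1 b * (q ^+ b) ^+ N.+1.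
  have -> : (1 - q ^+ N.+1) * \sum_(b < m.+1) kappa q m.+1 b * (q ^+ b) ^+ N.+1 =
     \sum_(b < m.+1) kappa q m.+1 b * (q ^+ b) ^+ N.+1 -
     \sum_(b < m.+1) kappa q m.+1 b * (q ^+ b.+1) ^+ N.+1.
    rewrite mulrBl mul1r mulr_sumr; congr (_ - _); apply: eq_bigr => b _.
    by rewrite mulrCA [q ^+ b.+1]exprS exprMn.
  have -> : \sum_(b < m.+1) kappa q m.+1 b * (q ^+ b) ^+ N.+1 =
     \sum_(b < m.+2) kappa q m.+2 b * (1 - q ^+ m.+1 / q ^+ b) * (q ^+ b) ^+ N.+1.
    rewrite [RHS]big_ord_recr /= divff ?expf_neq0 // subrr mulr0 mul0r addr0.
    by apply: eq_bigr => b _; rewrite kappa_last.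
  have -> : \sum_(b < m.+1) kappa q m.+1 b * (q ^+ b.+1) ^+ N.+1 =
     \sum_(b < m.+2) kappa q m.+2 b * (1 - (q ^+ b)^-1) * (q ^+ b) ^+ N.+1.
    rewrite [RHS]big_ord_recl /= expr0 invr1 subrr mulr0 mul0r add0r.
    by apply: eq_bigr => b _; rewrite kappa_first.
  rewrite mulr_sumr -sumrB; apply: eq_bigr => b _.
  rewrite [_ ^+ N.+1]exprS; have := expf_neq0 b q0.
  move: (kappa _ _ _) (q ^+ b) (q ^+ m.+1) => k y z y0.
  by move: (y ^+ N) => w; field.
rewrite (qpochSr _ q q) qpochS -exprS -exprSr invfM.
have h : 1 - q ^+ m.+1 != 0 by rewrite subr_eq0 eq_sym q1.
apply: (mulfI h); rewrite key IH; field.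
by rewrite h qpoch_neq0.
Qed.

(** Induction on [b]: the step trades 1 - q^(m-1-b) u for 1 - q^(-b-1) u in the last product, and (1
    - q^(b+1)/u)(1 - q^(m-1-b) u) = (q^m - q^(b+1)/u)(1 - q^(-b-1) u). *)
Lemma pair_cancel (u : K) m b : u != 0 ->
  \prod_(c < b) (1 - q ^+ c.+1 / u) * \prod_(c < m) (1 - q ^+ c * u) =
  \prod_(c < b) (q ^+ m - q ^+ c.+1 / u) * \prod_(c < m) (1 - q ^+ c / q ^+ b * u).
Proof.
move=> u0; elim: b => [|b IH].
  by rewrite !big_ord0 !mul1r; apply: eq_bigr => c _; rewrite expr0 divr1.
rewrite !big_ord_recr /= -mulrA (mulrCA (\prod_(c < b) _)) IH mulrCA -!mulrA; congr (_ * _).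
have qb := expf_neq0 b q0.
case: m {IH} => [|m]; first by rewrite !big_ord0 expr0.
rewrite [in LHS]big_ord_recr /= [in RHS]big_ord_recl /= mulrCA [RHS]mulrA mulrC.
congr (_ * _); last first.
  apply: eq_bigr => c _; congr (1 - _ * u); rewrite /bump /= add1n !exprS.
  by rewrite -mulf_div divff ?mul1r.
by rewrite !exprS; field; rewrite u0 q0 qb.
Qed.

End Kappa.

(** With T_i the sum of the [g j] over j >= i, the [i]-th summand is q^T_(i+1) - q^T_i. *)
Lemma telescope (R : comNzRingType) (q : R) s (g : 'I_s -> nat) :
  \sum_(i < s) q ^+ (\sum_(j < s | (i < j)%N) g j) * (1 - q ^+ g i) = 1 - q ^+ (\sum_i g i).
Proof.
elim: s g => [|s IH] g; first by rewrite !big_ord0 expr0 subrr.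
rewrite big_ord_recl /=.
have -> : (\sum_(j < s.+1 | (0 < j)%N) g j = \sum_(j < s) g (lift ord0 j))%N.
  by rewrite big_mkcond big_ord_recl.
under eq_bigr => i _.
  rewrite big_mkcond big_ord_recl /= add0n -big_mkcond /=.
  over.
rewrite IH [in RHS]big_ord_recl exprD; ring.
Qed.

(** * Formal Laurent polynomials and leading terms in one variable *)

Lemma lmon_mulE s (m1 m2 : lmon s) : lmon_mul m1 m2 = m1 + m2.
Proof. by congr pair; apply/ffunP => i; rewrite !ffunE. Qed.

Lemma lmon_oneE s : lmon_one s = 0.
Proof. by []. Qed.

Section Coefficients.
Variables (R : comNzRingType) (s : nat).
Implicit Types (p : lpol R s) (m : lmon s).

Lemma lpcoef_cat p1 p2 m : lpcoef (p1 ++ p2) m = lpcoef p1 m + lpcoef p2 m.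
Proof. by rewrite /lpcoef big_cat. Qed.

Lemma lpcoef_mul p1 p2 m :
  lpcoef (lpmul p1 p2) m = \sum_(t <- p1) t.1 * lpcoef p2 (m - t.2).
Proof.
rewrite /lpcoef /lpmul big_mkcond big_allpairs_dep; apply: eq_bigr => t _.
rewrite mulr_sumr [RHS]big_mkcond; apply: eq_bigr => t' _ /=.
by rewrite lmon_mulE (addrC t.2) eq_sym -subr_eq eq_sym.
Qed.

Lemma lpcoef_mulA p1 p2 p3 m :
  lpcoef (lpmul (lpmul p1 p2) p3) m = lpcoef (lpmul p1 (lpmul p2 p3)) m.
Proof.
rewrite !lpcoef_mul big_allpairs_dep; apply: eq_bigr => t _.
rewrite lpcoef_mul mulr_sumr; apply: eq_bigr => t' _ /=.
by rewrite lmon_mulE opprD addrA mulrA.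
Qed.

Lemma lpmul1p p : lpmul (lpone R s) p = p.
Proof.
rewrite /lpmul /= cats0 -[RHS]map_id; apply: eq_map => t /=.
by rewrite mul1r lmon_mulE lmon_oneE add0r -surjective_pairing.
Qed.

Lemma lpmul_all (Pm : pred (lmon s)) p1 p2 :
  {in Pm &, forall m1 m2, Pm (m1 + m2)} ->
  all (fun t => Pm t.2) p1 -> all (fun t => Pm t.2) p2 ->
  all (fun t => Pm t.2) (lpmul p1 p2).
Proof.
move=> PD /allP h1 /allP h2; apply/allP => _ /allpairsP[[t1 t2] /= [/h1 ? /h2 ? ->]].
by rewrite /= lmon_mulE PD.
Qed.

Lemma big_lpmul_all (Pm : pred (lmon s)) (I : Type) (r : seq I) (P : pred I) (F : I -> lpol R s) :
  Pm 0 -> {in Pm &, forall m1 m2, Pm (m1 + m2)} ->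
  (forall i, P i -> all (fun t => Pm t.2) (F i)) ->
  all (fun t => Pm t.2) (\big[@lpmul R s/lpone R s]_(i <- r | P i) F i).
Proof.
move=> P0 PD PF; apply: (big_ind (fun p => all (fun t => Pm t.2) p)) => //.
- by rewrite /= andbT.
- by move=> p1 p2; apply: lpmul_all.
Qed.

(* [p] is a power series in [z_a] whose constant term is [c * p0]. *)
Definition has_lead (a : 'I_s) (c : R) p0 p := forall m,
  (m.1 a < 0 -> lpcoef p m = 0) /\ (m.1 a = 0 -> lpcoef p m = c * lpcoef p0 m).

(** [f] behaves as a power series in [z_a] whose constant term is the scalar [g]. Stating this
    through the action on every [p] makes it stable under products. *)
Definition lead_factor (a : 'I_s) (g : R) f := forall c p0 p,
  has_lead a c p0 p -> has_lead a (g * c) p0 (lpmul f p).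

(** [zratio a j] raises the exponent of [z_a] by one, so its term cannot reach exponents up to 0. *)
Lemma lead_factor_binomial (a j : 'I_s) (g h : R) : j != a ->
  lead_factor a g [:: (g, lmon_one s); (h, zratio a j)].
Proof.
move=> ja c p0 p H m; rewrite lpcoef_mul !big_cons big_nil addr0 /= lmon_oneE subr0.
have e : (m - zratio a j).1 a = m.1 a - 1 by rewrite !ffunE eqxx eq_sym (negbTE ja) subr0.
have z : m.1 a <= 0 -> lpcoef p (m - zratio a j) = 0.
  by move=> ma; apply: (H _).1; rewrite e; lia.
split => ma; first by rewrite z ?(H _).1 ?mulr0 ?addr0 // ltW.
by rewrite z ?ma // (H _).2 // mulr0 addr0 mulrA.
Qed.

Lemma big_lead_factor (a : 'I_s) (I : finType) (P : pred I) (g : I -> R) (F : I -> lpol R s) :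
  (forall i, P i -> lead_factor a (g i) (F i)) ->
  lead_factor a (\prod_(i | P i) g i) (\big[@lpmul R s/lpone R s]_(i | P i) F i).
Proof.
move=> PF; apply: (big_ind2 (fun c p => lead_factor a c p)) => //.
- by move=> c p0 p H; rewrite mul1r lpmul1p.
- move=> g1 f1 g2 f2 H1 H2 c p0 p H m; rewrite lpcoef_mulA -(mulrA g1).
  exact: H1 (H2 _ _ _ H) m.
Qed.

Lemma has_lead_refl (a : 'I_s) p :
  all (fun t : R * lmon s => t.2.1 a == 0) p -> has_lead a 1 p p.
Proof.
move=> /allP h m; split; last by rewrite mul1r.
move=> ma; rewrite /lpcoef big_seq_cond big1 // => t /andP[/h h0 /eqP e].
by move: ma; rewrite -e (eqP h0).
Qed.

End Coefficients.

(** * Evaluation of formal lists in a field *)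

Definition wle (R : nzRingType) s (p : lpol R s) := all (fun t : R * lmon s => t.2.2 <= 0) p.

Arguments wle {R s}.

Section Evaluation.
Variables (R : fieldType) (s : nat) (K : fieldType) (iota : {rmorphism R -> K}).
Variable z : 'I_s -> K.
Hypothesis z0 : forall i, z i != 0.

Definition mon (m : lmon s) : K := \prod_i z i ^ m.1 i.

(* [w_1^-1] is sent to ['X]; only meaningful on lists satisfying [wle]. *)
Definition ev (p : lpol R s) : {poly K} :=
  \sum_(t <- p) (iota t.1 * mon t.2) *: 'X^(absz t.2.2).

Lemma monD m1 m2 : mon (m1 + m2) = mon m1 * mon m2.
Proof.
rewrite /mon -big_split; apply: eq_bigr => i _ /=.
by rewrite ffunE expfzDr.
Qed.

Lemma mon0 : mon 0 = 1.
Proof. by rewrite /mon big1 // => i _; rewrite ffunE expr0z. Qed.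

Lemma mon_zratio i j : mon (zratio i j) = z i / z j.
Proof.
rewrite /mon.
have -> : \prod_l z l ^ (zratio i j).1 l = \prod_l (z l ^ ((l == i) : nat) * (z l ^+ (l == j))^-1).
  by apply: eq_bigr => l _; rewrite ffunE expfzDr // -exprnN.
rewrite big_split /= (bigD1 i) //= [X in _ * X](bigD1 j) //= !eqxx expr1.
rewrite big1 ?mulr1; last by move=> l /negbTE->.
by rewrite big1 ?mulr1 // => l /negbTE->; rewrite invr1.
Qed.

Lemma mon_var i (n : nat) (w : int) :
  mon ([ffun l => if l == i then n%:Z else 0], w) = z i ^+ n.
Proof.
rewrite /mon (bigD1 i) //= ffunE eqxx big1 ?mulr1 // => l /negbTE li.
by rewrite ffunE li expr0z.
Qed.

Lemma ev_cat p1 p2 : ev (p1 ++ p2) = ev p1 + ev p2.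
Proof. by rewrite /ev big_cat. Qed.

Lemma ev_mul p1 p2 : wle p1 -> wle p2 -> ev (lpmul p1 p2) = ev p1 * ev p2.
Proof.
move=> /allP h1 /allP h2; rewrite /ev big_allpairs_dep mulr_suml big_seq [RHS]big_seq.
apply: eq_bigr => t1 /h1 t1w; rewrite mulr_sumr big_seq [RHS]big_seq.
apply: eq_bigr => t2 /h2 t2w /=; rewrite lmon_mulE monD rmorphM.
rewrite -scalerAl -scalerAr scalerA -exprD; congr (_ *: 'X^_); first by rewrite mulrACA.
move: t1w t2w; rewrite /=; lia.
Qed.

Lemma ev_one : ev (lpone R s) = 1.
Proof. by rewrite /ev big_seq1 /= lmon_oneE mon0 rmorph1 mul1r scale1r expr0. Qed.

Lemma snd_le0D : {in (fun m : lmon s => m.2 <= 0) &, forall m1 m2, (m1 + m2).2 <= 0}.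
Proof.
move=> m1 m2 h1 h2; rewrite -[X in _ <= X](addr0 0); exact: lerD h1 h2.
Qed.

Lemma wle_mul p1 p2 : wle p1 -> wle p2 -> wle (@lpmul R s p1 p2).
Proof.
by apply: (@lpmul_all _ _ (fun m => m.2 <= 0)); exact: snd_le0D.
Qed.

Lemma wle_big (I : Type) (r : seq I) (P : pred I) (F : I -> lpol R s) :
  (forall i, P i -> wle (F i)) -> wle (\big[@lpmul R s/lpone R s]_(i <- r | P i) F i).
Proof.
by move=> PF; apply: (@big_lpmul_all _ _ (fun m => m.2 <= 0)) => //; exact: snd_le0D.
Qed.

Lemma ev_big (I : Type) (r : seq I) (P : pred I) (F : I -> lpol R s) :
  (forall i, P i -> wle (F i)) ->
  ev (\big[@lpmul R s/lpone R s]_(i <- r | P i) F i) = \prod_(i <- r | P i) ev (F i).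
Proof.
move=> PF; elim: r => [|i r IH]; first by rewrite !big_nil ev_one.
rewrite !big_cons; case: ifP => // Pi; rewrite ev_mul ?IH ?PF //; exact: wle_big.
Qed.

Lemma ev_coef p n : wle p ->
  (ev p)`_n = \sum_(t <- p | t.2.2 == - n%:Z) iota t.1 * mon t.2.
Proof.
move=> /allP h; rewrite /ev coef_sum [RHS]big_mkcond big_seq [RHS]big_seq.
apply: eq_bigr => t /h tw; rewrite coefZ coefXn.
have -> : (n == absz t.2.2) = (t.2.2 == - n%:Z) by move: (t.2.2) tw => w /= tw; apply/eqP/eqP; lia.
by case: ifP => _; rewrite ?mulr1 ?mulr0.
Qed.

End Evaluation.

(** * The Dyson product and the cancellation of denominators *)

Section Product.
Variables (K : fieldType) (s : nat) (beta : 'I_s -> nat) (q : K) (z : 'I_s -> K).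
Hypothesis q0 : q != 0.
Hypothesis z0 : forall i, z i != 0.

(* With the shift [j < i], the Dyson product becomes the product of the [gK i j] over
   all ordered pairs [i != j]. *)
Definition gK (i j : 'I_s) : K :=
  \prod_(c < beta i) (1 - q ^+ (c + (j < i)) * (z i / z j)).

Definition dK (S : {set 'I_s}) : K := \prod_(i in S) \prod_(j in S :\ i) gK i j.

(* What is left of [gK i j * gK j i] after division by the factors
   [1 - q^c z_j / (q^b z_i)] of the denominator. *)
Definition QK (i : 'I_s) (b : nat) (j : 'I_s) : K :=
  \prod_(c < beta i) ((if (c < b + (i < j))%N then q ^+ beta j else 1)
                      - q ^+ (c + (j < i)) * (z i / z j)).

Definition xK (y : {i : 'I_s & 'I_(beta i)}) : K := q ^+ tagged y * z (tag y).

(** A_x for the alphabet restricted to the variables in [S]; the recursion for the constant term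
    removes variables one at a time. *)
Definition AK (S : {set 'I_s}) y : K :=
  (\prod_(y' | (tag y' \in S) && (y' != y)) (1 - xK y' / xK y))^-1.

(** With [u = q ^+ e * (z j / z i)], [gK j i] is the product of the 1 - q^c u, and the first [b + e]
    factors of [gK i j] are 1 - q^(c+1)/u. So [pair_cancel] shifts [u] to q^-b z_j/z_i, which gives
    the denominator. *)
Lemma gK_pair (i j : 'I_s) (b : nat) : i != j -> (b < beta i)%N ->
  gK i j * gK j i = QK i b j * \prod_(c < beta j) (1 - q ^+ c * z j / (q ^+ b * z i)).
Proof.
move=> ij bi; pose e : nat := (i < j)%N.
have ji : ((j < i)%N : nat) = (1 - e)%N.
  by rewrite /e; move: ij; rewrite -(inj_eq val_inj) /=; case: ltngtP.
(* [b < beta i] ensures that [gK i j] has the [b + e] factors to be rewritten. *)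
have be : (b + e <= beta i)%N by rewrite /e; lia.
pose u := q ^+ e * (z j / z i).
have u0 : u != 0 by rewrite !mulf_neq0 ?invr_neq0 ?expf_neq0.
have qe (c : nat) : q ^+ c.+1 / u = q ^+ (c + (j < i)) * (z i / z j).
  rewrite ji /u; case: (e) (leq_b1 (i < j)%N : (e <= 1)%N) => [|[|//]] _.
    by rewrite expr0 subn0 addn1; field; rewrite !z0.
  by rewrite subnn addn0 expr1 exprS; field; rewrite !z0 q0.
pose h (c : nat) := 1 - q ^+ (c + (j < i)) * (z i / z j).
pose h' (c : nat) := q ^+ beta j - q ^+ (c + (j < i)) * (z i / z j).
have cancel : \prod_(c < beta i | (c < b + e)%N) h c * \prod_(c < beta j) (1 - q ^+ c * u) =
  \prod_(c < beta i | (c < b + e)%N) h' c *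
  \prod_(c < beta j) (1 - q ^+ c / q ^+ (b + e) * u).
  rewrite -!big_ord_widen //.
  under eq_bigr do rewrite /h -qe.
  by rewrite pair_cancel //; congr (_ * _); apply: eq_bigr => c _; rewrite /h' qe.
rewrite /gK (bigID (fun c : 'I_(beta i) => (c < b + e)%N)) /= mulrAC.
have -> : \prod_(c < beta j) (1 - q ^+ (c + (i < j)) * (z j / z i)) =
          \prod_(c < beta j) (1 - q ^+ c * u).
  by apply: eq_bigr => c _; rewrite /u exprD -mulrA.
rewrite cancel /QK [in RHS](bigID (fun c : 'I_(beta i) => (c < b + e)%N)) /= [RHS]mulrAC.
congr (_ * _); last by apply: eq_bigr => c /negbTE; rewrite -/e => ->.
congr (_ * _); first by apply: eq_bigr => c; rewrite -/e => ->.
apply: eq_bigr => c _; rewrite /u exprD; congr (1 - _); field.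
by rewrite z0 !expf_neq0.
Qed.

Lemma dK_remove (S : {set 'I_s}) i : i \in S ->
  dK S = (\prod_(j in S :\ i) (gK i j * gK j i)) * dK (S :\ i).
Proof.
move=> iS; rewrite /dK (big_setD1 i) //= big_split /= -mulrA; congr (_ * _).
rewrite -big_split /=; apply: eq_bigr => j; rewrite !inE => /andP[ji jS].
rewrite (big_setD1 i) /=; last by rewrite !inE eq_sym ji.
by congr (_ * _); apply: eq_bigl => k; rewrite !inE; do !case: (_ == _).
Qed.

Lemma AK_inv (S : {set 'I_s}) (i : 'I_s) (b : 'I_(beta i)) : i \in S ->
  AK S (Tagged (fun i => 'I_(beta i)) b) = kappa q (beta i) b /
    \prod_(j in S :\ i) \prod_(c < beta j) (1 - q ^+ c * z j / (q ^+ b * z i)).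
Proof.
move=> iS; rewrite /AK /kappa -invfM; congr (_^-1).
rewrite -(@sig_big_dep _ _ _ _ (fun i => 'I_(beta i)) (mem S)
  (fun j c => Tagged (fun i => 'I_(beta i)) c != Tagged (fun i => 'I_(beta i)) b)
  (fun j c => 1 - q ^+ c * z j / xK (Tagged (fun i => 'I_(beta i)) b))) /=.
rewrite (big_setD1 i) //=; congr (_ * _).
  apply: eq_big => [c|c _]; first by rewrite eq_Tagged.
  rewrite /xK /=; congr (1 - _); field; by rewrite z0 expf_neq0.
apply: eq_bigr => j; rewrite !inE => /andP[ji _]; apply: eq_bigl => c.
by apply: contra ji => /eqP/(congr1 tag) /= ->.
Qed.

(** The denominators in [AK_inv] are what [gK_pair] extracts from the pairs containing [i]; the
    condition on the [z j] makes them nonzero. *)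
Lemma dK_AK (S : {set 'I_s}) (i : 'I_s) (b : 'I_(beta i)) : i \in S ->
  (forall j (c : 'I_(beta j)), j != i -> q ^+ c * z j != q ^+ b * z i) ->
  dK S * AK S (Tagged (fun i => 'I_(beta i)) b) =
  kappa q (beta i) b * \prod_(j in S :\ i) QK i b j * dK (S :\ i).
Proof.
move=> iS zz; rewrite AK_inv // (dK_remove _ i iS).
have -> : \prod_(j in S :\ i) (gK i j * gK j i) =
  \prod_(j in S :\ i) QK i b j *
  \prod_(j in S :\ i) \prod_(c < beta j) (1 - q ^+ c * z j / (q ^+ b * z i)).
  rewrite -big_split /=; apply: eq_bigr => j; rewrite !inE => /andP[ji _].
  by rewrite (gK_pair _ _ b) // eq_sym.
have : \prod_(j in S :\ i) \prod_(c < beta j) (1 - q ^+ c * z j / (q ^+ b * z i)) != 0.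
  apply/prodf_neq0 => j; rewrite !inE => /andP[ji _]; apply/prodf_neq0 => c _.
  rewrite subr_eq0 eq_sym; apply: contra (zz j c ji) => /eqP/divr1_eq ->; exact: eqxx.
move: (\prod_(j in S :\ i) \prod_(c < beta j) _) => p p0.
by field.
Qed.

End Product.

Arguments mon {s K}.
Arguments ev {R s K}.

(** * Faithfulness of evaluation in the field of rational functions *)

Section FractionField.
Variables (R : fieldType) (s : nat).

Definition fracK : fieldType := {fraction {mpoly R[s]}}.

Definition iotaK : {rmorphism R -> fracK} := (@tofrac {mpoly R[s]}) \o (@mpolyC s R).

Definition zK (i : 'I_s) : fracK :=
  tofrac ('X_i : {mpoly R[s]}).

Lemma zK_neq0 i : zK i != 0.
Proof.
rewrite /zK tofrac_eq0; apply/eqP => /(congr1 (mcoeff U_(i)%MM)) /eqP.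
by rewrite mcoeffX eqxx mcoeff0 oner_eq0.
Qed.

(** Exponents after multiplication by (z_1...z_s)^M; [absz] changes nothing once [M] bounds the
    negative exponents. *)
Definition shiftm (M : nat) (m : lmon s) : 'X_{1..s} :=
  [multinom absz (m.1 i + M%:Z)%R | i < s]%MM.

Lemma mon_shift M (m : lmon s) : (forall i, - M%:Z <= m.1 i) ->
  mon zK m * \prod_i zK i ^+ M = tofrac (mpolyX R (shiftm M m)).
Proof.
move=> hm; rewrite /mon -big_split /= mpolyXE_id rmorph_prod.
apply: eq_bigr => i _; rewrite rmorphXn /= mnmE -/(zK i).
rewrite -[zK i ^+ M]/(zK i ^ M%:Z) -expfzDr ?zK_neq0 //.
have := hm i; move: (m.1 i) => x hx.
by rewrite -[RHS]/(zK i ^ (absz (x + M%:Z))%:Z) gez0_abs //; lia.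
Qed.

Lemma lower_bound (l : seq (lmon s)) :
  exists M : nat, forall m, m \in l -> forall i : 'I_s, - M%:Z <= m.1 i.
Proof.
elim: l => [|m l [M IH]]; first by exists 0%N.
exists (M + \sum_i absz (m.1 i))%N => m'; rewrite inE => /orP[/eqP ->|/IH h] i; last first.
  have := h i; lia.
rewrite (bigD1 i) //=; lia.
Qed.

(** One common shift turns both evaluations into images of polynomials, whose coefficients can be
    compared. The two degrees may differ because [expansion] compares with a list free of [w_1]. *)
Lemma lpcoef_inj (p p' : lpol R s) (k : {ffun 'I_s -> int}) (n n' : nat) :
  wle p -> wle p' -> (ev iotaK zK p)`_n = (ev iotaK zK p')`_n' ->
  lpcoef p (k, - n%:Z) = lpcoef p' (k, - n'%:Z).
Proof.
move=> wp wp'; rewrite !ev_coef //.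
(* The target [k] is included, since its shift must also determine it. *)
have [M hM] := lower_bound ((k, 0) :: [seq t.2 | t <- p ++ p']).
have hk i : - M%:Z <= k i by apply: (hM (k, 0)); rewrite inE eqxx.
have toP (p1 : lpol R s) w : {subset p1 <= p ++ p'} ->
  (\sum_(t <- p1 | t.2.2 == w) iotaK t.1 * mon zK t.2) * \prod_i zK i ^+ M =
  tofrac (\sum_(t <- p1 | t.2.2 == w) mpolyC s t.1 * mpolyX R (shiftm M t.2)).
  move=> sub; rewrite rmorph_sum mulr_suml big_seq_cond [RHS]big_seq_cond.
  apply: eq_bigr => t /andP[/sub tp _]; rewrite -mulrA mon_shift ?rmorphM //.
  by move=> i; apply: hM; rewrite inE map_f ?orbT.
have coefP (p1 : lpol R s) w : {subset p1 <= p ++ p'} ->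
  mcoeff (shiftm M (k, 0))
   (\sum_(t <- p1 | t.2.2 == w) mpolyC s t.1 * mpolyX R (shiftm M t.2)) =
  lpcoef p1 (k, w).
  move=> sub; rewrite raddf_sum /= /lpcoef big_mkcond [RHS]big_mkcond big_seq [RHS]big_seq.
  apply: eq_bigr => t /sub tp; rewrite mcoeffCM mcoeffX.
  rewrite -[t.2 == _]/((t.2.1 == k) && (t.2.2 == w)).
  have -> : (shiftm M t.2 == shiftm M (k, 0)) = (t.2.1 == k).
    apply/eqP/eqP => [/mnmP h|<-].
      apply/ffunP => i; have := h i; rewrite !mnmE /=.
      have : - M%:Z <= t.2.1 i by apply: hM; rewrite inE map_f ?orbT.
      by have := hk i; move: (t.2.1 i) (k i) => x y; lia.
    by apply/mnmP => i; rewrite !mnmE.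
  by case: (_ == k); case: (_ == w); rewrite ?mulr1 ?mulr0.
move=> /(congr1 (fun x => x * \prod_i zK i ^+ M)).
have sp : {subset p <= p ++ p'} by move=> t tp; rewrite mem_cat tp.
have sp' : {subset p' <= p ++ p'} by move=> t tp; rewrite mem_cat tp orbT.
by rewrite !toP // => /eqP; rewrite tofrac_eq => /eqP e; rewrite -coefP // e coefP.
Qed.

End FractionField.

Arguments iotaK {R s}.
Arguments zK {R s}.

(** * The partial fraction expansion when [q] is neither 0 nor a root of unity *)

Lemma big_tag (T : Type) (idx : T) (op : Monoid.com_law idx) (I : finType) (J : I -> finType)
    (P : pred I) (F : {i : I & J i} -> T) :
  \big[op/idx]_(y | P (tag y)) F y =
  \big[op/idx]_(i | P i) \big[op/idx]_(j : J i) F (Tagged J j).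
Proof.
rewrite (sig_big_dep P (fun i => xpredT) (fun i j => F (Tagged J j))) /=.
by apply: eq_big => [[i j]|[i j] _] //=; rewrite andbT.
Qed.
Arguments big_tag {T idx op I J}.

Section GenericBase.
Variables (R : fieldType) (s : nat) (beta : 'I_s -> nat) (q : R).
Hypothesis q0 : q != 0.
Hypothesis q1 : forall m, (0 < m)%N -> q ^+ m != 1.
Hypothesis beta0 : forall i, (0 < beta i)%N.

Variables (K : fieldType) (phi : {rmorphism R -> K}) (z : 'I_s -> K).
Hypothesis z0 : forall i, z i != 0.
Hypothesis ev_inj : forall (p p' : lpol R s) (k : {ffun 'I_s -> int}) (n n' : nat),
  wle p -> wle p' -> (ev phi z p)`_n = (ev phi z p')`_n' ->
  lpcoef p (k, - n%:Z) = lpcoef p' (k, - n'%:Z).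
Let Q : K := phi q.
Hypothesis qz_neq : forall (i j : 'I_s) (c b : nat), j != i -> Q ^+ c * z j != Q ^+ b * z i.
Let Q0 : Q != 0.
Proof. by rewrite fmorph_eq0. Qed.
Let Q1 m : (0 < m)%N -> Q ^+ m != 1.
Proof. by move=> m0; rewrite -rmorphXn fmorph_eq1 q1. Qed.

(** [gl], [Dl] and [Ql] are formal versions of [gK], [dK] and [QK]: identities are checked on
    evaluations, coefficients are read from the lists. *)
Definition gl (i j : 'I_s) : lpol R s :=
  \big[@lpmul R s/lpone R s]_(c < beta i)
    [:: (1, lmon_one s); (- q ^+ (c + (j < i)), zratio i j)].

Definition Dl (S : {set 'I_s}) : lpol R s :=
  \big[@lpmul R s/lpone R s]_(i in S) \big[@lpmul R s/lpone R s]_(j in S :\ i) gl i j.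

Definition Ql (i : 'I_s) (b : nat) (j : 'I_s) : lpol R s :=
  \big[@lpmul R s/lpone R s]_(c < beta i)
    [:: (if (c < b + (i < j))%N then q ^+ beta j else 1, lmon_one s);
        (- q ^+ (c + (j < i)), zratio i j)].

(* [kappa q (beta i) b * residue S i b] is [D_S * A_x] for [x = q^b z_i]. *)
Definition residue (S : {set 'I_s}) (i : 'I_s) (b : nat) : lpol R s :=
  lpmul (\big[@lpmul R s/lpone R s]_(j in S :\ i) Ql i b j) (Dl (S :\ i)).

Lemma wle_gl i j : wle (gl i j).
Proof. by apply: wle_big. Qed.

Lemma wle_Ql i b j : wle (Ql i b j).
Proof. by apply: wle_big. Qed.

Lemma wle_Dl S : wle (Dl S).
Proof. by apply: wle_big => i _; apply: wle_big => j _; exact: wle_gl. Qed.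

Lemma wle_residue S i b : wle (residue S i b).
Proof.
by apply: wle_mul; [apply: wle_big => j _; exact: wle_Ql | exact: wle_Dl].
Qed.

Lemma ev_binomial (g h : R) i j :
  ev phi z [:: (g, lmon_one s); (- h, zratio i j)] = (phi g - phi h * (z i / z j))%:P.
Proof.
rewrite /ev !big_cons big_nil /= lmon_oneE mon0 mon_zratio // !expr0 addr0 mulr1.
by rewrite !alg_polyC -polyCD rmorphN mulNr.
Qed.

Lemma ev_gl i j : ev phi z (gl i j) = (gK _ s beta Q z i j)%:P.
Proof.
rewrite ev_big // rmorph_prod; apply: eq_bigr => c _.
by rewrite ev_binomial rmorph1 rmorphXn.
Qed.

Lemma ev_Ql i b j : ev phi z (Ql i b j) = (QK _ s beta Q z i b j)%:P.
Proof.
rewrite ev_big // rmorph_prod; apply: eq_bigr => c _.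
by rewrite ev_binomial rmorphXn; case: ifP => _; rewrite ?rmorph1 ?rmorphXn.
Qed.

Lemma ev_Dl S : ev phi z (Dl S) = (dK _ s beta Q z S)%:P.
Proof.
rewrite ev_big // => [|i _]; last by apply: wle_big => j _; exact: wle_gl.
rewrite rmorph_prod; apply: eq_bigr => i _.
rewrite ev_big // => [|j _]; last exact: wle_gl.
by rewrite rmorph_prod; apply: eq_bigr => j _; exact: ev_gl.
Qed.

Lemma ev_residue S i b : ev phi z (residue S i b) =
  ((\prod_(j in S :\ i) QK _ s beta Q z i b j) * dK _ s beta Q z (S :\ i))%:P.
Proof.
rewrite ev_mul ?wle_Dl //; last by apply: wle_big => j _; exact: wle_Ql.
rewrite ev_Dl polyCM ev_big => [||j _] //; last exact: wle_Ql.
by congr (_ * _); rewrite rmorph_prod; apply: eq_bigr => j _; exact: ev_Ql.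
Qed.

Lemma xK_inj : injective (xK _ s beta Q z).
Proof.
move=> [i b] [j c]; rewrite /xK /= => e.
have ij : i = j by apply/eqP; apply: contraT => /(fun h => qz_neq _ _ b c h); rewrite e eqxx.
case: _ / ij in c e *; congr (Tagged _ _); apply: val_inj => /=.
by apply: (expq_inj _ Q) => //; apply: mulIf e.
Qed.

Lemma xK_neq0 y : xK _ s beta Q z y != 0.
Proof. by rewrite mulf_neq0 ?expf_neq0. Qed.

Lemma phi_kappa m b : phi (kappa q m b) = kappa Q m b.
Proof.
rewrite /kappa fmorphV rmorph_prod; congr (_^-1); apply: eq_bigr => c _.
by rewrite rmorphB rmorph1 fmorph_div !rmorphXn.
Qed.

Definition zpow (i : 'I_s) (n : nat) : lmon s := ([ffun l => if l == i then n%:Z else 0], 0).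

(** By [dK_AK], each product of [dK], A_x and x^n is the evaluation of a multiple of [residue] times
    [z_i^n]. Faithfulness of evaluation transfers the identity to coefficients. *)
Lemma expansion (S : {set 'I_s}) (p : lpol R s) (m n : nat) (k : {ffun 'I_s -> int}) :
  wle p ->
  (ev phi z p)`_m = dK _ s beta Q z S *
    \sum_(y | tag y \in S) AK _ s beta Q z S y * xK _ s beta Q z y ^+ n ->
  lpcoef p (k, - m%:Z) =
  \sum_(i in S) \sum_(b < beta i) kappa q (beta i) b * (q ^+ b) ^+ n *
     lpcoef (residue S i b) ((k, 0) - zpow i n).
Proof.
move=> wp evp.
pose T (i : 'I_s) (b : nat) : lpol R s :=
  lpmul [:: (kappa q (beta i) b * (q ^+ b) ^+ n, zpow i n)] (residue S i b).
have wT i b : wle (T i b) by apply: wle_mul; rewrite ?wle_residue //= lexx.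
pose p' := \big[cat/[::]]_(i in S) \big[cat/[::]]_(b < beta i) T i b.
have catE (I : finType) (P : pred I) (F : I -> lpol R s) : (forall i, P i -> wle (F i)) ->
  [/\ wle (\big[cat/[::]]_(i | P i) F i),
  forall m, lpcoef (\big[cat/[::]]_(i | P i) F i) m = \sum_(i | P i) lpcoef (F i) m &
  ev phi z (\big[cat/[::]]_(i | P i) F i) = \sum_(i | P i) ev phi z (F i)].
  move=> wF; split.
  - apply: (big_ind (fun p : lpol R s => wle p)) => // p1 p2 h1 h2.
    by rewrite /wle all_cat; apply/andP.
  - move=> m'; apply: (big_morph (fun p => lpcoef p m')) => [p1 p2|]; first exact: lpcoef_cat.
    exact: big_nil.
  - apply: (big_morph (ev phi z)) => [p1 p2|]; first exact: ev_cat.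
    exact: big_nil.
have wT' i : i \in S -> wle (\big[cat/[::]]_(b < beta i) T i b).
  by move=> _; case: (catE _ xpredT (fun b : 'I_(beta i) => T i b)).
have [wp' cp' ep'] := catE _ (mem S) _ wT'.
(* [p'] does not involve [w_1], hence the degree 0 on its side. *)
rewrite (ev_inj p p' k m 0) //; last first.
  rewrite evp ep' coef_sum.
  rewrite (big_tag (mem S)) /=.
  rewrite mulr_sumr; apply: eq_bigr => i iS.
  have [_ _ ->] := catE _ xpredT (fun b : 'I_(beta i) => T i b) (fun b _ => wT i b).
  rewrite coef_sum mulr_sumr; apply: eq_bigr => b _.
  rewrite mulrA dK_AK //; last by move=> *; exact: qz_neq.
  rewrite ev_mul ?wle_residue //.
  rewrite ev_residue /ev big_seq1 /= expr0 alg_polyC -polyCM coefC eqxx.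
  rewrite mon_var rmorphM phi_kappa !rmorphXn /xK /= exprMn -!mulrA.
  by congr (_ * _); rewrite mulrA [RHS]mulrA mulrC.
rewrite oppr0 cp'; apply: eq_bigr => i _.
have [_ -> _] := catE _ xpredT (fun b : 'I_(beta i) => T i b) (fun b _ => wT i b).
by apply: eq_bigr => b _; rewrite lpcoef_mul big_seq1.
Qed.

(** This is [lagrange_one] at ['X = 0]. *)
Lemma AK_sum (S : {set 'I_s}) : S != set0 ->
  \sum_(y | tag y \in S) AK _ s beta Q z S y = 1.
Proof.
move=> /set0Pn[i iS].
have := lagrange_one _ _ (fun y => tag y \in S) (xK _ s beta Q z).
move=> /(_ (in2W xK_inj) (in1W xK_neq0)) => h.
have /(congr1 (fun p : {poly K} => p`_0)) := h (ex_intro _ (Tagged _ (Ordinal (beta0 i))) iS).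
rewrite coef_sum coef1 eqxx => e; rewrite -[RHS]e; apply: eq_bigr => y _; rewrite coefZ.
rewrite -horner_coef0 horner_prod [X in _ * X]big1 ?mulr1 // => y' _.
by rewrite hornerD hornerN hornerZ hornerX hornerC mulr0 subr0.
Qed.

(** * Leading terms of the residues and the q-Dyson theorem *)

Lemma Dl_exponent (S : {set 'I_s}) i : i \notin S ->
  all (fun t : R * lmon s => t.2.1 i == 0) (Dl S).
Proof.
move=> iS.
have clo : {in (fun m : lmon s => m.1 i == 0) &,
    forall m1 m2 : lmon s, (m1 + m2 : lmon s).1 i == 0}.
  by move=> m1 m2 /eqP h1 /eqP h2; rewrite !ffunE h1 h2.
have z00 : (0 : lmon s).1 i == 0 by rewrite ffunE.
apply: (@big_lpmul_all _ _ (fun m => m.1 i == 0)) => // j jS.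
apply: (@big_lpmul_all _ _ (fun m => m.1 i == 0)) => // l; rewrite !inE => /andP[_ lS].
apply: (@big_lpmul_all _ _ (fun m => m.1 i == 0)) => // c _.
rewrite /= !ffunE.
have /negbTE-> : i != j by apply: contraNneq iS => ->.
by have /negbTE-> : i != l by apply: contraNneq iS => ->.
Qed.

(** In [Ql i b j], exactly [b + (i < j)] factors have constant term [q ^+ beta j] and the others 1;
    this count is at most [beta i] because [b < beta i]. The remaining factor [Dl (S :\ i)] is free
    of [z_i]. *)
Lemma residue_lead (S : {set 'I_s}) i b : (b < beta i)%N ->
  has_lead _ s i (\prod_(j in S :\ i) q ^+ (beta j * (b + (i < j)))) (Dl (S :\ i)) (residue S i b).
Proof.
move=> bi; rewrite -[X in has_lead _ _ _ X]mulr1.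
have lead : lead_factor R s i (\prod_(j in S :\ i) q ^+ (beta j * (b + (i < j))))
   (\big[@lpmul R s/lpone R s]_(j in S :\ i) Ql i b j).
  apply: big_lead_factor => j; rewrite !inE => /andP[ji _].
  have -> : q ^+ (beta j * (b + (i < j))) =
      \prod_(c < beta i) (if (c < b + (i < j))%N then q ^+ beta j else 1).
    rewrite -big_mkcond -(big_ord_widen _ (fun=> q ^+ beta j)).
      by rewrite prodr_const card_ord exprM.
    by case: (i < j)%N; lia.
  by apply: big_lead_factor => c _; apply: lead_factor_binomial.
apply: lead; apply: has_lead_refl; apply: Dl_exponent; by rewrite !inE eqxx.
Qed.

(** The leading constant splits into [(q ^+ b) ^+ N] and a power of [q] independent of [b]. The
    former joins [(q ^+ b) ^+ n], so [sum_kappa] applies with [N + n]. *)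
Lemma residue_sum (S : {set 'I_s}) i n : i \in S ->
  let N := (\sum_(j in S :\ i) beta j)%N in
  \sum_(b < beta i) kappa q (beta i) b * (q ^+ b) ^+ n * lpcoef (residue S i b) 0 =
  q ^+ (\sum_(j < s | (i < j)%N) (if j \in S then beta j else 0)) *
  (qpoch (q ^+ (N + n).+1) q (beta i).-1 / qpoch q q (beta i).-1) * lpcoef (Dl (S :\ i)) 0.
Proof.
move=> iS N; rewrite -(sum_kappa _ _ q0 q1) prednK // [X in _ = X * _]mulr_sumr [RHS]mulr_suml.
apply: eq_bigr => b _; rewrite (residue_lead S i b (ltn_ord b) 0).2 ?ffunE //.
rewrite [LHS]mulrA; congr (_ * _).
rewrite prodrXr -!exprM -mulrA -exprD [RHS]mulrCA -exprD.
congr (_ * q ^+ _).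
have -> : (\sum_(j < s | (i < j)%N) (if j \in S then beta j else 0) =
           \sum_(j in S :\ i) beta j * (i < j))%N.
  rewrite big_mkcond [in RHS]big_mkcond; apply: eq_bigr => j _; rewrite !inE.
  rewrite -(inj_eq val_inj) /=.
  by case: ltngtP => _; case: (j \in S); rewrite ?muln1 ?muln0.
rewrite /N; under eq_bigr do rewrite mulnDr.
rewrite big_split /= -big_distrl /= mulnDr (mulnC b (\sum_(_ in _) _)).
by rewrite addnC -addnA addnCA.
Qed.

(** Induction on the size of [S]: [AK_sum] puts [Dl S] into the form required by [expansion] with
    exponent 0, and the resulting terms telescope. *)
Lemma qdyson (S : {set 'I_s}) :
  lpcoef (Dl S) 0 = qpoch q q (\sum_(i in S) beta i) / \prod_(i in S) qpoch q q (beta i).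
Proof.
have [k] := ubnP #|S|; elim: k S => // k IH S; rewrite ltnS => Sk.
have [->|S0] := eqVneq S set0.
  rewrite /Dl !big_set0 /lpcoef big_cons big_nil eqxx addr0.
  by rewrite /qpoch big_ord0 divr1.
have exp0 : (0 : lmon s) = (0, - 0%:Z) by rewrite oppr0.
rewrite [in LHS]exp0 (expansion S _ 0 0) ?wle_Dl //; last first.
  rewrite ev_Dl coefC eqxx; under eq_bigr do rewrite expr0 mulr1.
  by rewrite AK_sum // mulr1.
set B := (\sum_(i in S) beta i)%N.
set C := qpoch q q B.-1 / \prod_(i in S) qpoch q q (beta i).
(* Extending [beta] by 0 outside [S] adds only zero terms, so [telescope] applies to all indices. *)
pose g j := if j \in S then beta j else 0%N.
have gB : (\sum_j g j = B)%N by rewrite -big_mkcond.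
have B0 : (0 < B)%N.
  by case/set0Pn: S0 => i iS; rewrite /B (bigD1 i) //= ltn_addr.
transitivity (\sum_(i in S) q ^+ (\sum_(j < s | (i < j)%N) g j) * (1 - q ^+ g i) * C).
  apply: eq_bigr => i iS.
  have -> : (0, 0) - zpow i 0 = 0 :> lmon s.
    by congr pair; apply/ffunP => l; rewrite !ffunE; case: ifP.
  rewrite residue_sum // addn0 IH; last first.
    by rewrite (leq_trans _ Sk) // [X in (_ < X)%N](cardsD1 i) iS.
  rewrite -!mulrA; congr (_ * _); rewrite /C /g iS.
  set N := (\sum_(j in S :\ i) beta j)%N.
  have BN : (B = beta i + N)%N by rewrite /B (big_setD1 i).
  have -> : (B.-1 = N + (beta i).-1)%N by have := beta0 i; lia.
  (* (q;q)_N from the induction and (q^(N+1);q)_(beta_i - 1) from [residue_sum] merge into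
     (q;q)_(B-1), which is the same for every [i]. *)
  rewrite qpochD [in RHS](big_setD1 i) //= -exprSr.
  rewrite -[in X in _ = _ * (_ / (X * _))](prednK (beta0 i)) qpochSr -exprSr prednK //.
  have n1 := qpoch_neq0 _ q q1 (beta i).-1.
  have n2 : \prod_(j in S :\ i) qpoch q q (beta j) != 0.
    by apply/prodf_neq0 => j _; apply: qpoch_neq0.
  have n3 : 1 - q ^+ beta i != 0 by rewrite subr_eq0 eq_sym q1.
  by field; rewrite n1 n2 n3.
rewrite -mulr_suml big_mkcond.
rewrite (eq_bigr (fun i : 'I_s => q ^+ (\sum_(j < s | (i < j)%N) g j) * (1 - q ^+ g i))); last first.
  move=> i _; case: ifP => // iS.
  by have -> : g i = 0%N by [rewrite /g iS]; rewrite expr0 subrr mulr0.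
rewrite telescope gB /C mulrA; congr (_ / _).
by rewrite -[in RHS](prednK B0) qpochSr -exprSr prednK // mulrC.
Qed.

(** * Evaluation of the truncated product and its coefficients *)

Lemma ev_lgeom (c : R) i N :
  ev phi z (lgeom c (zw i) N) = \sum_(t < N.+1) ((phi c * z i) ^+ t) *: 'X^t.
Proof.
rewrite /ev /lgeom big_map -[iota 0 N.+1]/(index_iota 0 N.+1) big_mkord; apply: eq_bigr => t _ /=.
have -> : absz ((- 1 : int) *+ t) = t by rewrite -mulr_natr mulN1r abszN natz.
congr (_ *: _); rewrite rmorphXn exprMn; congr (_ * _).
rewrite -(mon_var _ _ z i t 0); apply: eq_bigr => l _; rewrite !ffunE.
by case: (l == i); rewrite ?mul0rn // -mulr_natr mul1r natz.
Qed.

Lemma wle_lgeom (c : R) i N : wle (lgeom c (@zw s i) N).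
Proof.
apply/allP => _ /mapP[t _ ->] /=.
by rewrite -mulr_natr mulN1r oppr_le0 natz.
Qed.

Lemma wle_lqpoch (c : R) (i j : 'I_s) b : wle (lqpoch c q (zratio i j) b).
Proof. by apply: wle_big. Qed.

Lemma wle_Ftrunc N : wle (Ftrunc beta q N).
Proof.
apply: wle_mul; apply: wle_big => i _; apply: wle_big => j _.
  by apply: wle_mul; apply: wle_lqpoch.
exact: wle_lgeom.
Qed.

Lemma dK_setT : dK _ s beta Q z setT =
  \prod_(i < s) \prod_(j < s | (i < j)%N) (gK _ s beta Q z i j * gK _ s beta Q z j i).
Proof.
rewrite /dK; under [RHS]eq_bigr do rewrite big_split /=.
rewrite big_split /= [X in _ = _ * X](exchange_big_dep xpredT) //= -big_split /=.
apply: eq_big => [i|i _]; first by rewrite inE.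
rewrite (bigID (fun j : 'I_s => (i < j)%N)) /=; congr (_ * _); apply: eq_bigl => j.
  by rewrite !inE andbT -(inj_eq val_inj) /=; case: ltngtP.
by rewrite !inE andbT -(inj_eq val_inj) /=; case: ltngtP.
Qed.

Lemma ev_Ftrunc (N : nat) : ev phi z (Ftrunc beta q N) =
  (dK _ s beta Q z setT)%:P *
  \prod_y \sum_(t < N.+1) (xK _ s beta Q z y ^+ t) *: 'X^t.
Proof.
rewrite ev_mul //; last 2 first.
- by apply: wle_big => i _; apply: wle_big => j _; apply: wle_mul; apply: wle_lqpoch.
- by apply: wle_big => i _; apply: wle_big => j _; exact: wle_lgeom.
congr (_ * _).
  rewrite dK_setT ev_big // => [|i _]; last first.
    by apply: wle_big => j _; apply: wle_mul; apply: wle_lqpoch.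
  rewrite rmorph_prod; apply: eq_bigr => i _.
  rewrite ev_big // => [|j _]; last by apply: wle_mul; apply: wle_lqpoch.
  rewrite rmorph_prod; apply: eq_bigr => j ij.
  (* For i < j the shift is 0 in [gl i j] and 1 in [gl j i], the latter matching the argument q
     z_j/z_i. *)
  transitivity (ev phi z (gl i j) * ev phi z (gl j i)); last by rewrite !ev_gl -polyCM.
  rewrite ev_mul ?wle_lqpoch //; congr (_ * _); congr ev.
    by apply: eq_bigr => c _; rewrite mulr1 ltnNge (ltnW ij) addn0.
  by apply: eq_bigr => c _; rewrite ij addn1 exprSr.
rewrite ev_big // => [|i _]; last by apply: wle_big => j _; exact: wle_lgeom.
rewrite (big_tag xpredT); apply: eq_bigr => i _.
rewrite ev_big // => [|b _]; last exact: wle_lgeom.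
by apply: eq_bigr => b _; rewrite ev_lgeom mulr1 rmorphXn.
Qed.

Lemma Fcoef_expansion (k : 'I_s -> int) (n : nat) : (0 < s)%N ->
  Fcoef beta q k n =
  \sum_(i < s) \sum_(b < beta i) kappa q (beta i) b * (q ^+ b) ^+ n *
     lpcoef (residue setT i b) (([ffun i => k i], 0) - zpow i n).
Proof.
move=> s0; rewrite /Fcoef (expansion setT _ n n) ?wle_Ftrunc //.
  by apply: eq_bigl => i; rewrite inE.
rewrite ev_Ftrunc coefCM; congr (_ * _).
rewrite (@complete_homogeneous _ _ xpredT) //; last 3 first.
- exact: in2W xK_inj.
- exact: in1W xK_neq0.
- by exists (Tagged (fun i => 'I_(beta i)) (Ordinal (beta0 (Ordinal s0)))).
apply: eq_big => [y|y _]; first by rewrite inE.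
by rewrite /AK; congr (_^-1 * _); apply: eq_bigl => y'; rewrite inE.
Qed.

(** Division by [z_i^n] leaves the exponent k_i - n < 0 in [z_i], where the residue for [i] has no
    terms. *)
Lemma Fcoef_vanish (k : 'I_s -> int) (n : nat) : (0 < s)%N ->
  (forall i, k i < n%:Z) -> Fcoef beta q k n = 0.
Proof.
move=> s0 kn; rewrite Fcoef_expansion // big1 // => i _; rewrite big1 // => b _.
rewrite (residue_lead _ i b (ltn_ord b) _).1 ?mulr0 //.
by rewrite !ffunE eqxx subr_lt0.
Qed.

(** For [i != a] the exponent of [z_i] becomes -n < 0, so only [i = a] contributes. There the
    constant term of the residue is needed, and [qdyson] supplies the part from the other
    variables. *)
Lemma Fcoef_peak (a : 'I_s) (n : nat) : (0 < n)%N ->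
  let N := (\sum_(j in setT :\ a) beta j)%N in
  Fcoef beta q (fun i => if i == a then n%:Z else 0) n =
  q ^+ (\sum_(j < s | (a < j)%N) beta j) *
  (qpoch (q ^+ (N + n).+1) q (beta a).-1 / qpoch q q (beta a).-1) *
  (qpoch q q N / \prod_(i in setT :\ a) qpoch q q (beta i)).
Proof.
move=> n0 N; rewrite Fcoef_expansion; last exact: leq_ltn_trans (leq0n a) (ltn_ord a).
rewrite (bigD1 a) //= [X in _ + X]big1 ?addr0; last first.
  move=> i ia; rewrite big1 // => b _.
  rewrite (residue_lead _ i b (ltn_ord b) _).1 ?mulr0 //.
  by rewrite !ffunE eqxx (negbTE ia) sub0r oppr_lt0.
have -> : ([ffun i => if i == a then n%:Z else 0], 0) - zpow a n = 0 :> lmon s.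
  by rewrite subrr.
rewrite residue_sum // qdyson; congr (q ^+ _ * _ * _).
by apply: eq_bigr => j _; rewrite inE.
Qed.

End GenericBase.

(** The coefficient of [z_j] is q^c on the left and 0 on the right. *)
Lemma zK_qneq (R : fieldType) s (q : R) (i j : 'I_s) (c b : nat) : q != 0 -> j != i ->
  (iotaK q : fracK R s) ^+ c * zK j != iotaK q ^+ b * zK i.
Proof.
move=> q0 ji; rewrite /zK -!rmorphXn /= -!rmorphM tofrac_eq.
apply/eqP => /(congr1 (mcoeff U_(j)%MM)) /eqP.
rewrite !mcoeffCM !mcoeffX eqxx eq_mnm1 [i == j]eq_sym (negbTE ji) mulr0 mulr1.
by rewrite expf_eq0 (negbTE q0) andbF.
Qed.

(** * Compatibility with ring morphisms *)

Section Transfer.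
Variables (R S : comNzRingType) (f : {rmorphism R -> S}) (s : nat).

Definition lpmap (p : lpol R s) : lpol S s := [seq (f t.1, t.2) | t <- p].

Lemma lpcoef_map p m : lpcoef (lpmap p) m = f (lpcoef p m).
Proof. by rewrite /lpcoef big_map rmorph_sum. Qed.

Lemma lpmap_mul p1 p2 : lpmap (lpmul p1 p2) = lpmul (lpmap p1) (lpmap p2).
Proof.
rewrite /lpmap /lpmul map_allpairs allpairs_mapl allpairs_mapr.
by apply: eq_allpairs => t1 t2; rewrite rmorphM.
Qed.

Lemma lpmap_big (I : Type) (r : seq I) (P : pred I) (F : I -> lpol R s) :
  lpmap (\big[@lpmul R s/lpone R s]_(i <- r | P i) F i) =
  \big[@lpmul S s/lpone S s]_(i <- r | P i) lpmap (F i).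
Proof.
by apply: (big_morph lpmap); [exact: lpmap_mul | rewrite /lpmap /= rmorph1].
Qed.

Lemma lpmap_qpoch (c q : R) (m : lmon s) b : lpmap (lqpoch c q m b) = lqpoch (f c) (f q) m b.
Proof.
rewrite lpmap_big; apply: eq_bigr => i _.
by rewrite /lpmap /= rmorph1 rmorphN rmorphM rmorphXn.
Qed.

Lemma lpmap_qpoch_inv (c q : R) (m : lmon s) b N :
  lpmap (lqpoch_inv c q m b N) = lqpoch_inv (f c) (f q) m b N.
Proof.
rewrite lpmap_big; apply: eq_bigr => i _.
rewrite /lpmap /lgeom -map_comp; apply: eq_map => t /=.
by rewrite rmorphXn rmorphM rmorphXn.
Qed.

Lemma Fcoef_rmorph (beta : 'I_s -> nat) q k n : Fcoef beta (f q) k n = f (Fcoef beta q k n).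
Proof.
rewrite /Fcoef -lpcoef_map; congr (lpcoef _ _).
rewrite /Ftrunc lpmap_mul !lpmap_big; congr (lpmul _ _); apply: eq_bigr => i _.
  rewrite lpmap_big; apply: eq_bigr => j _.
  by rewrite lpmap_mul !lpmap_qpoch rmorph1.
by rewrite lpmap_qpoch_inv rmorph1.
Qed.

Lemma qpoch_rmorph z q m : f (qpoch z q m) = qpoch (f z) (f q) m.
Proof.
rewrite /qpoch rmorph_prod; apply: eq_bigr => i _.
by rewrite rmorphB rmorph1 rmorphM rmorphXn.
Qed.

End Transfer.

(** * The identities over [{poly R}] with [q = 'X] *)

Section PolynomialBase.
Variables (R : fieldType) (s : nat) (beta : 'I_s -> nat).
Hypothesis beta0 : forall i, (0 < beta i)%N.

Variables (L : fieldType) (f : {rmorphism {poly R} -> L}).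
Hypothesis f_inj : injective f.
Let X : L := f 'X.

Lemma fracX_neq0 : X != 0.
Proof. by rewrite -(rmorph0 f) (inj_eq f_inj) polyX_eq0. Qed.

Lemma fracX_exp m : (0 < m)%N -> X ^+ m != 1.
Proof.
move=> m0; rewrite -rmorphXn -(rmorph1 f) (inj_eq f_inj); apply/eqP => /(congr1 (fun p : {poly R} => size p)).
by rewrite size_polyXn size_poly1; case: m m0.
Qed.

Lemma Fcoef_polyX_vanish (k : 'I_s -> int) n : (0 < s)%N ->
  (forall i, k i < n%:Z) -> Fcoef beta ('X : {poly R}) k n = 0.
Proof.
move=> s0 kn; apply: f_inj; rewrite rmorph0 -Fcoef_rmorph.
apply: (Fcoef_vanish _ _ _ _ fracX_neq0 fracX_exp beta0 _ iotaK zK) => //.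
- exact: zK_neq0.
- exact: lpcoef_inj.
- by move=> *; apply: zK_qneq => //; exact: fracX_neq0.
Qed.

(** Denominators are cleared so that the identity lives in [{poly R}] and can be evaluated at any
    element of [R]. *)
Lemma Fcoef_polyX_peak (a : 'I_s) n : (0 < n)%N ->
  let N := (\sum_(j in setT :\ a) beta j)%N in
  Fcoef beta ('X : {poly R}) (fun i => if i == a then n%:Z else 0) n *
  (qpoch 'X 'X (beta a).-1 * \prod_(i in setT :\ a) qpoch 'X 'X (beta i)) =
  'X ^+ (\sum_(j < s | (a < j)%N) beta j) * qpoch ('X ^+ (N + n).+1) 'X (beta a).-1 *
  qpoch 'X 'X N.
Proof.
move=> n0 N; apply: f_inj.
have qE p m : f (qpoch p 'X m) = qpoch (f p) X m by exact: qpoch_rmorph.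
have pE : f (\prod_(i in setT :\ a) qpoch 'X 'X (beta i)) =
    \prod_(i in setT :\ a) qpoch X X (beta i).
  by rewrite rmorph_prod; apply: eq_bigr => i _; exact: qE.
rewrite !rmorphM pE !qE !rmorphXn -Fcoef_rmorph -/X.
rewrite (Fcoef_peak _ _ _ _ fracX_neq0 fracX_exp beta0 _ iotaK zK) //; last 3 first.
- exact: zK_neq0.
- exact: lpcoef_inj.
- by move=> *; apply: zK_qneq => //; exact: fracX_neq0.
rewrite -/N.
have h m := qpoch_neq0 _ _ fracX_exp m.
have hp : \prod_(i in setT :\ a) qpoch X X (beta i) != 0 by apply/prodf_neq0.
by field; rewrite h hp.
Qed.

End PolynomialBase.

(** * Specialization of the indeterminate to [q] *)

Theorem theorem4p5 (R : fieldType) (s : nat) (beta : 'I_s -> nat) (q : R)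
    (n : nat) :
  (1 <= s)%N ->
  (forall i, (0 < beta i)%N) ->
  (0 < n)%N ->
  (forall i, qpoch q q (beta i) != 0) ->
  (forall k : 'I_s -> int, (forall i, k i < n%:Z) -> Fcoef beta q k n = 0) /\
  (forall a : 'I_s,
     let B := (\sum_(i < s) beta i)%N in
     Fcoef beta q (fun i => if i == a then n%:Z else 0) n =
       q ^+ (\sum_(j < s | (a < j)%N) beta j)
       * ((1 - q ^+ beta a) * qpoch q q (B - beta a)
          / \prod_(i < s) qpoch q q (beta i))
       * qpoch (q ^+ (B - beta a + n + 1)) q (beta a - 1)).
Proof.
move=> s0 beta0 n0 qn0.
have tofracI : injective (@tofrac {poly R}) by move=> x y /eqP; rewrite tofrac_eq => /eqP.
have [g gX] : exists g : {rmorphism {poly R} -> R}, g 'X = q.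
  by exists (horner_eval q); rewrite /= /horner_eval hornerX.
split=> [k kn|a B].
  by rewrite -gX Fcoef_rmorph (Fcoef_polyX_vanish _ _ _ beta0 _ _ tofracI) // rmorph0.
have /(congr1 g) := Fcoef_polyX_peak _ _ _ beta0 _ _ tofracI a n n0.
have qE p m : g (qpoch p 'X m) = qpoch (g p) q m.
  by rewrite qpoch_rmorph gX.
have pE : g (\prod_(i in setT :\ a) qpoch 'X 'X (beta i)) =
    \prod_(i in setT :\ a) qpoch q q (beta i).
  by rewrite rmorph_prod; apply: eq_bigr => i _; rewrite qE gX.
rewrite !rmorphM pE !qE !rmorphXn -Fcoef_rmorph gX.
set N := (\sum_(j in setT :\ a) beta j)%N => peak.
have BN : (B - beta a = N)%N.
  by rewrite /B (bigD1 a) //= addKn; apply: eq_bigl => j; rewrite !inE andbT.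
have prodE : \prod_(i < s) qpoch q q (beta i) =
    qpoch q q (beta a) * \prod_(i in setT :\ a) qpoch q q (beta i).
  by rewrite (bigD1 a) //=; congr (_ * _); apply: eq_bigl => j; rewrite !inE andbT.
have aE : qpoch q q (beta a) = qpoch q q (beta a).-1 * (1 - q ^+ beta a).
  by rewrite -[in LHS](prednK (beta0 a)) qpochSr -exprSr prednK.
(* [h1] and [hp] allow the cleared denominators to be restored; [h2] cancels the factor
   [1 - q ^+ beta a] of the stated formula. *)
have := qn0 a; rewrite aE mulf_eq0 negb_or => /andP[h1 h2].
have hp : \prod_(i in setT :\ a) qpoch q q (beta i) != 0 by apply/prodf_neq0.
rewrite BN prodE aE addn1 subn1; apply: (mulIf (mulf_neq0 h1 hp)); rewrite peak.
move: (\prod_(i in _) _) (qpoch q q (beta a).-1) (1 - _ ^+ beta a) hp h1 h2 => u v d u0 v0 d0.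
move: (q ^+ _) (qpoch _ _ _) (qpoch q q N) => x y w.
by field; rewrite u0 v0 d0.
Qed.
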